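(* Let $f:\mathbb{R}^n\to\mathbb{R}$ be the quadratic $f(x)=\frac12 x^THx+g^Tx+c$, where $H\in\mathbb{R}^{n\times n}$ is symmetric with $n-1$ positive eigenvalues and one negative eigenvalue, $g\in\mathbb{R}^n$ and $c\in\mathbb{R}$. Let $l\in\mathbb{R}$ and let $v\in\mathbb{R}^n$ be a unit vector such that $v^THv<0$. Then: (i) For every $x\in\mathbb{R}^n$, the set $S_{l,v}(x)$ is a (possibly degenerate) line segment or empty, and whenever it is nonempty, $g_{l,v}(x)=g_{l,v,1}(x)+g_{l,v,2}(x)$. (ii) For every $x\in\mathbb{R}^n$, $$g_{l,v}(x)^2=\max\Big\{0,\ \frac{4}{(v^THv)^2}\Big[x^T[Hvv^TH-(v^THv)H]x+2[(g^Tv)v^TH-(v^THv)g^T]x+\big[(g^Tv)^2+(v^THv)(-2c+2l)\big]\Big]\Big\}.$$ (iii) If $v$ is sufficiently close to a unit eigenvector corresponding to the negative eigenvalue of $H$, then at every $x$ with $g_{l,v}(x)>0$ the Hessian matrix $\nabla^2(g_{l,v}^2)(x)$ has $n-1$ positive eigenvalues and one zero eigenvalue. (iv) The function $g_{l,v}^2$ is convex. (v) Let $\bar x=-H^{-1}g$ be the saddle point of $f$. If $l<f(\bar x)$ and $g_{l,v}^2$ has a minimizer $\tilde x$, then $\bar x$ is the midpoint of the intersection of the line $\{\tilde x\}+\mathbb{R}\{v\}$ with $\{y: f(y)=l\}$ (that is, the midpoint of the two intersection points).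
   Context: For $x\in\mathbb{R}^n$, a unit vector $v$ and $l\in\mathbb{R}$, set $S_{l,v}(x):=\{x+tv: t\in\mathbb{R},\ f(x+tv)\ge l\}$ (here the neighborhoods in the definition of the parallel distance are taken to be all of $\mathbb{R}^n$). The parallel distance is $g_{l,v}(x):=\operatorname{diam}(S_{l,v}(x))$, where $\operatorname{diam}(C)=\sup\{\|x-y\|:x,y\in C\}$, and $g_{l,v}(x)=0$ if $S_{l,v}(x)=\emptyset$. Further $g_{l,v,1}(x)=\max\{v^Tz: f(z)=l,\ z\in S_{l,v}(x)\}$ and $g_{l,v,2}(x)=\max\{-v^Tz': f(z')=l,\ z'\in S_{l,v}(x)\}$. The vector $g$ in the definition of $f$ is unrelated to the functions $g_{l,v},g_{l,v,1},g_{l,v,2}$, and $g_{l,v}^2$ denotes $x\mapsto g_{l,v}(x)^2$. *)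

(* Defs.v *)
From mathcomp Require Export all_boot all_order all_algebra.
From mathcomp Require Export all_classical all_reals all_analysis.
Export Order.TTheory GRing.Theory Num.Theory numFieldNormedType.Exports.

#[export] Set Implicit Arguments.
#[export] Unset Strict Implicit.
#[export] Unset Printing Implicit Defensive.

Global Open Scope classical_set_scope.
Global Open Scope ring_scope.

(* The library norm `|v| on matrices is the maximum norm, hence a separate
   Euclidean norm. *)
Definition enorm (R : realType) (n : nat) (v : 'cV[R]_n) : R :=
  Num.sqrt (\sum_i v i 0 ^+ 2).

Definition qform (R : realType) (n : nat) (A : 'M[R]_n) (v : 'cV[R]_n) : R :=
  (v^T *m A *m v) 0 0.

Definition quad (R : realType) (n : nat) (H : 'M[R]_n) (g : 'cV[R]_n) (c : R)
  (x : 'cV[R]_n) : R := 2^-1 * qform H x + (g^T *m x) 0 0 + c.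

(* The list s consists of the eigenvalues of A, each repeated according to its
   multiplicity as a root of the characteristic polynomial; all n of them are
   required to be real. *)
Definition eigenvalue_list (R : realType) (n : nat) (A : 'M[R]_n)
    (s : seq R) : Prop :=
  char_poly A = \prod_(a <- s) ('X - a%:P).

Definition eigenvalue_signs (R : realType) (n : nat) (A : 'M[R]_n)
    (pos zero neg : nat) : Prop :=
  exists s : seq R,
    [/\ eigenvalue_list A s, count (fun a => 0 < a) s = pos,
        count (fun a => a == 0) s = zero & count (fun a => a < 0) s = neg].

Definition segment (R : realType) (n : nat) (a b : 'cV[R]_n)
    : set 'cV[R]_n :=
  [set (1 - t) *: a + t *: b | t in [set t : R | 0 <= t <= 1]].

(* sup is 0 on unbounded sets, so diam is the diameter only for bounded C. *)
Definition diam (R : realType) (n : nat) (C : set 'cV[R]_n) : R :=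
  sup [set enorm (y - z) | y in C & z in C].

Definition is_max (R : realType) (A : set R) (m : R) : Prop :=
  A m /\ ubound A m.

(* Junk value 0 when A has no greatest element. *)
Definition set_max (R : realType) (A : set R) : R := xget 0 (is_max A).

Section ParallelDistance.
Variables (R : realType) (n : nat) (f : 'cV[R]_n -> R) (l : R) (v : 'cV[R]_n).

Definition line_superlevel (x : 'cV[R]_n) : set 'cV[R]_n :=
  [set x + t *: v | t in [set t : R | l <= f (x + t *: v)]].

Definition parallel_dist (x : 'cV[R]_n) : R :=
  if line_superlevel x == set0 then 0 else diam (line_superlevel x).

Definition parallel_set1 (x : 'cV[R]_n) : set R :=
  [set (v^T *m z) 0 0 | z in [set z | f z = l /\ line_superlevel x z]].

Definition parallel_set2 (x : 'cV[R]_n) : set R :=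
  [set - (v^T *m z) 0 0 | z in [set z | f z = l /\ line_superlevel x z]].

Definition parallel_dist1 (x : 'cV[R]_n) : R := set_max (parallel_set1 x).

Definition parallel_dist2 (x : 'cV[R]_n) : R := set_max (parallel_set2 x).

Definition parallel_dist_sq (x : 'cV[R]_n) : R := parallel_dist x ^+ 2.

End ParallelDistance.

Definition partial (R : realType) (n : nat) (F : 'cV[R]_n -> R) (i : 'I_n)
    : 'cV[R]_n -> R :=
  'D_(delta_mx i 0) F.

Definition hessian (R : realType) (n : nat) (F : 'cV[R]_n -> R)
    (x : 'cV[R]_n) : 'M[R]_n :=
  \matrix_(i, j) partial (partial F j) i x.

(* Derivatives in the library are total functions, so the existence of the
   second derivative has to be asserted separately from hessian. *)
Definition twice_differentiable (R : realType) (n : nat) (F : 'cV[R]_n -> R)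
    (x : 'cV[R]_n) : Prop :=
  (\forall y \near x, differentiable F y) /\
  (forall i : 'I_n, differentiable (partial F i) x).

(* Main.v *)
Require Import Defs.
From mathcomp Require Import ring lra complex.

(** Restricted to a line with direction v, where s = v^T H v < 0, the function f
    is a concave parabola in the parameter t. With slope b = v^T H x + g^T v at
    t = 0, the inequality f (x + t v) >= l reads (s t + b)^2 <= D(x), where
    D(x) = b^2 - 2 s (f x - l). So the superlevel set is empty if D(x) < 0, and
    otherwise it is the segment of parameters t with
    |t + b / s| <= sqrt D(x) / |s|, of length 2 sqrt D(x) / |s|, at whose
    endpoints f = l (line_superlevel_segment, line_level_endpoints). This gives
    (i), and (ii) once D is expanded (parallel_dist_sqE, line_discrE).

    The quadratic part of D has the matrix A = H v v^T H - s H (discr_mx), and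
    everything else rests on A being positive semidefinite with kernel exactly
    the line spanned by v. As H has a single negative eigenvalue, its form is
    positive on some hyperplane (one_negative_hyperplane). Hence it is positive
    on every nonzero vector y with v^T H y = 0 (timelike_orthogonal_gt0). For
    y = x - (v^T H x / s) v one computes x^T A x = - s y^T H y, which is positive
    unless y = 0, that is, unless x is a multiple of v (discr_mx_gt0).

    Consequently the squared distance is the maximum of 0 and a convex
    quadratic polynomial, which is (iv). Where it is positive it is locally
    equal to that polynomial, so that its Hessian is a positive multiple of A;
    diagonalizing A gives n - 1 positive eigenvalues and one zero
    (psd_line_kernel_signs), which is (iii).

    For (v), at the saddle point xbar the gradient of f vanishes, which yields
    D(xbar + y) = y^T A y - 2 s (f xbar - l) (line_discr_saddle). If l < f xbar,
    this is positive, and minimal exactly when y is a multiple of v. The line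
    through a minimizer is then xbar + R v, along which f is symmetric about
    xbar. *)

(** * Diagonalization of real symmetric matrices *)

Section Diagonalization.
Variable R : realType.
Implicit Types n : nat.

Lemma char_poly_similar (F : fieldType) n (A B P : 'M[F]_n) :
  P \in unitmx -> P *m A = B *m P -> char_poly A = char_poly B.
Proof.
move=> Pu PAB; pose Q := map_mx (@polyC F) P.
have QE : Q *m char_poly_mx A = char_poly_mx B *m Q.
  by rewrite /char_poly_mx mulmxBr mulmxBl -!map_mxM PAB scalar_mxC.
apply: (mulfI (_ : \det Q != 0)).
  by rewrite det_map_mx polyC_eq0 -unitfE -unitmxE.
by rewrite -det_mulmx QE det_mulmx mulrC.
Qed.

(** The spectral theorem over R[i] gives a complex change of basis to a diagonal
    matrix, whose entries are real because A is Hermitian; two real matrices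
    similar over R[i] are similar over R. The basis obtained in this way need
    not be orthonormal. *)
Lemma real_symmetric_diagonalizable n (A : 'M[R]_n) : A^T = A ->
  exists P : 'M[R]_n, exists2 d : 'rV[R]_n,
    P \in unitmx & P *m A = diag_mx d *m P.
Proof.
move=> Asym; pose toC := map_mx (real_complex R).
have toC_real m k (M : 'M[R]_(m, k)) : toC m k M \is a realmx.
  by apply/mxOverP => i j; rewrite mxE complex_real.
have AC_herm : toC _ _ A \is hermsymmx.
  apply: realsym_hermsym (toC_real _ _ _).
  apply/is_hermitianmxP; rewrite expr0 scale1r; apply/matrixP => i j.
  by rewrite !mxE -[in LHS]Asym mxE.
have AC_normal := hermitian_normalmx AC_herm.
have d_real := hermitian_spectral_diag_real AC_herm.
pose D := diag_mx (spectral_diag (toC _ _ A)).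
have D_real : D \is a realmx.
  apply/mxOverP => i j; rewrite mxE; case: eqP => _; rewrite ?mulr0n ?real0//.
  by rewrite mulr1n (mxOverP d_real).
have /real_similar/(_ (toC_real _ _ _) D_real)[P] :
    simmx_in unitmx (toC _ _ A) D.
  exists (spectralmx (toC _ _ A)); first exact: spectral_unit.
  apply/simmxP; first exact: spectral_unit.
  rewrite {2}(orthomx_spectralP AC_normal) !mulmxA mulmxV ?mul1mx//.
  exact: spectral_unit.
move=> /andP[P_real P_unit] /(simmxP P_unit) PAD.
have [P0 PE] : exists P0, P = toC _ _ P0.
  exists (map_mx (@complex.Re R) P); apply/matrixP => i j.
  by rewrite !mxE RRe_real// (mxOverP P_real).
have [d0 dE] : exists d0, spectral_diag (toC _ _ A) = toC _ _ d0.
  exists (map_mx (@complex.Re R) (spectral_diag (toC _ _ A))).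
  apply/matrixP => i j; rewrite [RHS]mxE [in RHS]mxE.
  by apply/esym/RRe_real; rewrite (mxOverP d_real).
exists P0; exists d0.
  by rewrite -(map_unitmx (real_complex R)) -[map_mx _ _]PE.
apply: (map_mx_inj (f := real_complex R)); rewrite !map_mxM map_diag_mx.
by move: PAD; rewrite /D dE PE.
Qed.

Lemma eigenvalue_list_diag n (A P : 'M[R]_n) (d : 'rV[R]_n) :
  P \in unitmx -> P *m A = diag_mx d *m P ->
  eigenvalue_list A [seq d 0 i | i : 'I_n].
Proof.
move=> Pu PAd; rewrite /eigenvalue_list (char_poly_similar Pu PAd).
rewrite char_poly_trig ?diag_mx_is_trig// big_image/=.
by apply: eq_bigr => i _; rewrite !mxE eqxx mulr1n.
Qed.

Lemma eigenvalue_list_perm n (A : 'M[R]_n) s t :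
  eigenvalue_list A s -> eigenvalue_list A t -> perm_eq s t.
Proof. by move=> As At; apply: prod_XsubC_eq; rewrite -As -At. Qed.

Lemma count_image n (d : 'rV[R]_n) (a : pred R) :
  count a [seq d 0 i | i : 'I_n] = #|[pred i | a (d 0 i)]|.
Proof. by rewrite count_map cardE/= size_filter enumT; apply: eq_count. Qed.

End Diagonalization.

(** * Forms with one negative eigenvalue *)

Section OneNegative.
Variable R : realType.
Implicit Types n : nat.

Lemma qform_sum n (A : 'M[R]_n) x :
  qform A x = \sum_i \sum_j x i 0 * A i j * x j 0.
Proof.
rewrite /qform mxE exchange_big/=; apply: eq_bigr => j _.
by rewrite mxE mulr_suml; apply: eq_bigr => i _; rewrite mxE.
Qed.

Lemma qform_congr n (A P : 'M[R]_n) x :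
  qform A (P *m x) = qform (P^T *m A *m P) x.
Proof. by rewrite /qform trmx_mul !mulmxA. Qed.

Lemma qform1_ge0 n (x : 'cV[R]_n) : 0 <= qform 1%:M x.
Proof.
by rewrite /qform mulmx1 mxE; apply: sumr_ge0 => i _; rewrite mxE -expr2 sqr_ge0.
Qed.

Lemma qform1_gt0 n (x : 'cV[R]_n) : x != 0 -> 0 < qform 1%:M x.
Proof.
move=> x0; rewrite lt_neqAle qform1_ge0 andbT eq_sym; apply: contra x0.
rewrite /qform mulmx1 mxE psumr_eq0 => [/allP y0|i _]; last first.
  by rewrite mxE -expr2 sqr_ge0.
apply/eqP/matrixP => i j; rewrite ord1 [RHS]mxE; apply/eqP.
by have := y0 i (mem_index_enum _); rewrite /= mxE mulf_eq0 orbb.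
Qed.

(** Write P H = diag d P with d e < 0 and all other d i > 0. Since P need not be
    orthogonal, the Gram matrix G = P P^T enters: for x = P^T y one has
    x^T H x = y^T (diag d) G y, and G commutes with diag d. Hence G i j = 0
    unless d i = d j, so that on the hyperplane y e = 0 the form equals the
    squared norm of P^T (diag (sqrt d)) y. *)
Lemma one_negative_hyperplane n (H : 'M[R]_n) : H^T = H ->
  eigenvalue_signs H n.-1 0 1 ->
  exists w : 'rV[R]_n, forall x : 'cV[R]_n, x != 0 -> (w *m x) 0 0 = 0 ->
    0 < qform H x.
Proof.
move=> Hsym [s [Hs _ s0 sneg]].
have [P [d Pu PHd]] := real_symmetric_diagonalizable Hsym.
have /permP ps := eigenvalue_list_perm Hs (eigenvalue_list_diag Pu PHd).
move: s0 sneg; rewrite !ps !count_image => /card0_eq d0 /mem_card1[e de].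
have d_gt0 i : i != e -> 0 < d 0 i.
  move=> ie; have := de i; have := d0 i.
  rewrite !inE (negbTE ie) => /negbT di0 /negbT.
  by rewrite lt0r -leNgt di0.
have PTu : P^T \in unitmx by rewrite unitmx_tr.
pose G := P *m P^T.
have GE : P *m H *m P^T = diag_mx d *m G by rewrite PHd mulmxA.
have Gd i j : d 0 i * G i j = G i j * d 0 j.
  have GC : diag_mx d *m G = G *m diag_mx d.
    have GT : G^T = G by rewrite trmx_mul trmxK.
    have <- : (diag_mx d *m G)^T = diag_mx d *m G.
      by rewrite -GE !trmx_mul trmxK Hsym mulmxA.
    by rewrite trmx_mul tr_diag_mx GT.
  have := congr1 (fun M : 'M[R]_n => M i j) GC.
  by rewrite mul_diag_mx mul_mx_diag !mxE.
exists (delta_mx 0 e *m invmx P^T) => x x0 wx.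
have [y xE ye] : exists2 y, x = P^T *m y & y e 0 = 0.
  exists (invmx P^T *m x); first by rewrite mulKVmx.
  by move: wx; rewrite -mulmxA -rowE mxE.
have GP : P *m P^T = G by [].
clearbody G.
(* Num.sqrt (d 0 e) is 0, which is harmless because y e 0 = 0. *)
pose S := diag_mx (map_mx Num.sqrt d).
have -> : qform H x = qform 1%:M (P^T *m (S *m y)).
  rewrite xE !qform_congr trmxK mulmx1 GP GE !qform_sum.
  apply: eq_bigr => i _; apply: eq_bigr => j _.
  rewrite tr_diag_mx mul_mx_diag [in RHS]mxE !mul_diag_mx !mxE.
  have [->|ie] := eqVneq i e; first by rewrite ye !mul0r.
  have [->|je] := eqVneq j e; first by rewrite ye !mulr0.
  have [->|Gij] := eqVneq (G i j) 0; first by rewrite !(mulr0,mul0r).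
  have dij : d 0 j = d 0 i by apply: (mulfI Gij); rewrite -Gd mulrC.
  by rewrite dij -[in LHS](sqr_sqrtr (ltW (d_gt0 _ ie))); ring.
apply: qform1_gt0; apply: contra x0 => /eqP /(canRL (mulKmx PTu)).
rewrite mulmx0 => Sy0; suff y0 : y = 0 by rewrite xE y0 mulmx0.
apply/matrixP => i j; rewrite ord1 [RHS]mxE.
have [->//|ie] := eqVneq i e; apply/eqP.
have := congr1 (fun M : 'cV[R]_n => M i 0) Sy0; rewrite mul_diag_mx !mxE => /eqP.
by rewrite mulf_eq0 sqrtr_eq0 leNgt d_gt0.
Qed.

End OneNegative.

(** * Lorentzian forms and the discriminant matrix *)

Section Lorentzian.
Variable R : realType.
Implicit Types n : nat.

(** The bilinear form of the matrix A; qform A x is bform A x x. *)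
Definition bform n (A : 'M[R]_n) (x y : 'cV[R]_n) : R := (x^T *m A *m y) 0 0.

Lemma bform_lin n (A : 'M[R]_n) x a y b z :
  bform A x (a *: y + b *: z) = a * bform A x y + b * bform A x z.
Proof. by rewrite /bform mulmxDr -!scalemxAr !mxE. Qed.

Lemma bformC n (A : 'M[R]_n) x y : A^T = A -> bform A x y = bform A y x.
Proof.
move=> AT; rewrite /bform; have -> : x^T *m A *m y = (y^T *m A *m x)^T.
  by rewrite !trmx_mul trmxK AT mulmxA.
by rewrite mxE.
Qed.

Lemma qform_lin n (A : 'M[R]_n) a x b y : A^T = A ->
  qform A (a *: x + b *: y) =
  a ^+ 2 * qform A x + 2 * a * b * bform A x y + b ^+ 2 * qform A y.
Proof.
move=> AT; rewrite -[LHS]/(bform A _ _) bform_lin ![bform A _ x]bformC//.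
rewrite ![bform A _ y]bformC// !bform_lin (bformC y)// /qform.
rewrite -![(_ *m _) 0 0]/(bform A _ _).
ring.
Qed.

(** The combination z of y and v that lies in the hyperplane of
    one_negative_hyperplane satisfies z^T H z > 0; since y and v are
    H-orthogonal, z^T H z = (w v)^2 y^T H y + (w y)^2 v^T H v, whose second term
    is nonpositive. *)
Lemma timelike_orthogonal_gt0 n (H : 'M[R]_n) v y : H^T = H ->
  eigenvalue_signs H n.-1 0 1 -> qform H v < 0 ->
  y != 0 -> bform H v y = 0 -> 0 < qform H y.
Proof.
move=> Hsym Hsigns v_lt0 y0 vHy.
have [w wP] := one_negative_hyperplane Hsym Hsigns.
have wv0 : (w *m v) 0 0 != 0.
  apply: contraTneq v_lt0 => wv; rewrite -leNgt.
  have [->|/wP/(_ wv)/ltW//] := eqVneq v 0.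
  by rewrite /qform mulmx0 mxE.
pose z := (w *m v) 0 0 *: y + - (w *m y) 0 0 *: v.
have wz : (w *m z) 0 0 = 0.
  rewrite /z mulmxDr -!scalemxAr; move: (w *m y) (w *m v) => a b.
  by rewrite !mxE; ring.
have z0 : z != 0.
  apply: contra y0 => /eqP z0.
  (* Pairing z = 0 with v gives (w y) v^T H v = 0. *)
  have := bform_lin H v ((w *m v) 0 0) y (- (w *m y) 0 0) v.
  rewrite -/z z0 vHy mulr0 add0r /bform mulmx0 mxE => /esym/eqP.
  rewrite mulf_eq0 oppr_eq0 -[(_ *m v) 0 0]/(qform H v) (lt_eqF v_lt0) orbF.
  move=> /eqP wy.
  move: z0; rewrite /z wy oppr0 scale0r addr0 => /eqP.
  by rewrite scaler_eq0 (negbTE wv0).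
have := wP _ z0 wz; rewrite qform_lin// (bformC y)// vHy mulr0 addr0 sqrrN.
have : 0 < (w *m v) 0 0 ^+ 2 by rewrite exprn_even_gt0.
have := sqr_ge0 ((w *m y) 0 0).
move: ((w *m v) 0 0 ^+ 2) ((w *m y) 0 0 ^+ 2) => a b b0 a0 pos.
rewrite -(pmulr_rgt0 _ a0); nra.
Qed.

(** Where the squared parallel distance is positive, it is a quadratic
    polynomial in x whose second-order part is 4 / (v^T H v)^2 times the form of
    this matrix. *)
Definition discr_mx n (H : 'M[R]_n) (v : 'cV[R]_n) : 'M[R]_n :=
  H *m v *m v^T *m H - qform H v *: H.

Lemma tr_discr_mx n (H : 'M[R]_n) v :
  H^T = H -> (discr_mx H v)^T = discr_mx H v.
Proof.
move=> HT; rewrite /discr_mx linearB/= linearZ/= HT.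
by rewrite !trmx_mul trmxK HT !mulmxA.
Qed.

Lemma qform_discr_mx n (H : 'M[R]_n) v x : H^T = H ->
  qform (discr_mx H v) x = bform H v x ^+ 2 - qform H v * qform H x.
Proof.
move=> HT; rewrite {1}/qform /discr_mx mulmxBr mulmxBl -scalemxAr -scalemxAl.
rewrite [LHS]mxE; congr (_ + _); last by rewrite 2!mxE.
rewrite !mulmxA -2!(mulmxA (_ *m v)) mulmxA.
rewrite -[in LHS](mulmxA (x^T *m H *m v)) mxE big_ord1 -!/(bform _ _ _).
by rewrite bformC.
Qed.

Lemma discr_mx_ker n (H : 'M[R]_n) v : discr_mx H v *m v = 0.
Proof.
rewrite /discr_mx mulmxBl -scalemxAl -!mulmxA [v^T *m _]mulmxA.
rewrite [_ *m v]mx11_scalar -/(qform H v) mul_mx_scalar.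
by rewrite -scalemxAr subrr.
Qed.

Section Timelike.
Variables (n : nat) (H : 'M[R]_n) (v : 'cV[R]_n).
Hypotheses (HT : H^T = H) (Hs : eigenvalue_signs H n.-1 0 1).
Hypothesis v0 : qform H v < 0.

(** The reversed Cauchy-Schwarz inequality for the Lorentzian form H. *)
Lemma discr_mx_gt0 x : (forall a, x <> a *: v) -> 0 < qform (discr_mx H v) x.
Proof.
move=> xv; pose y := 1 *: x + - (bform H v x / qform H v) *: v.
have vHy : bform H v y = 0.
  rewrite bform_lin -[bform H v v]/(qform H v) mulNr divfK ?lt_eqF//.
  by rewrite mul1r subrr.
have y0 : y != 0.
  apply/eqP => /eqP; rewrite /y scale1r scaleNr subr_eq0 => /eqP; exact: xv.
have := timelike_orthogonal_gt0 HT Hs v0 y0 vHy.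
rewrite qform_discr_mx// qform_lin// (bformC x)//.
rewrite -(nmulr_rlt0 _ v0) => h; rewrite -oppr_lt0; move: h.
by congr (_ < _); field; rewrite lt_eqF.
Qed.

Lemma qform_discr_mx_line a : qform (discr_mx H v) (a *: v) = 0.
Proof. by rewrite /qform -mulmxA -scalemxAr discr_mx_ker scaler0 mulmx0 mxE. Qed.

Lemma discr_mx_ge0 x : 0 <= qform (discr_mx H v) x.
Proof.
have [[a ->]|xv] := pselect (exists a, x = a *: v).
  by rewrite qform_discr_mx_line.
by apply/ltW/discr_mx_gt0 => a xa; apply: xv; exists a.
Qed.

Lemma discr_mx_eq0 x : qform (discr_mx H v) x <= 0 -> exists a, x = a *: v.
Proof.
move=> qx; apply: contrapT => xv; move: qx; apply/negP; rewrite -ltNge.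
by apply/discr_mx_gt0 => a xa; apply: xv; exists a.
Qed.
End Timelike.

(** The rows of a diagonalizing matrix are independent eigenvectors, so that
    exactly one of them lies in the kernel line. *)
Lemma psd_line_kernel_signs n (A : 'M[R]_n) (v : 'cV[R]_n) :
  A^T = A -> v != 0 -> A *m v = 0 -> (forall x, 0 <= qform A x) ->
  (forall x : 'cV[R]_n, A *m x = 0 -> exists a, x = a *: v) ->
  eigenvalue_signs A n.-1 1 0.
Proof.
move=> AT v0 Av Apos Aker.
have [P [d Pu PAd]] := real_symmetric_diagonalizable AT.
pose p (i : 'I_n) := (row i P)^T.
have Ap i : A *m p i = d 0 i *: p i.
  rewrite -[LHS]trmxK trmx_mul trmxK AT -row_mul PAd -linearZ/=; congr (_^T).
  by apply/rowP => j; rewrite mxE mul_diag_mx !mxE.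
have p_lin i j a b : a *: p i = b *: p j -> i != j -> a = 0.
  move=> /(congr1 trmx); rewrite !linearZ/= !trmxK !rowE !scalemxAl.
  move=> /(can_inj (mulmxK Pu)) E ij.
  move: (congr1 (fun M : 'rV[R]_n => M 0 i) E); rewrite !mxE !eqxx (negbTE ij).
  by rewrite mulr1 mulr0.
have p0 i : p i != 0.
  apply/eqP => /(congr1 trmx); rewrite trmxK rowE linear0 => /(canRL (mulmxK Pu)).
  rewrite mul0mx => /rowP/(_ i)/eqP; by rewrite !mxE !eqxx oner_eq0.
have d_ge0 i : 0 <= d 0 i.
  have := Apos (p i); rewrite /qform -mulmxA Ap -scalemxAr mxE.
  by rewrite pmulr_lge0//; have := qform1_gt0 (p0 i); rewrite /qform mulmx1.
have [e de] : exists e, d 0 e = 0.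
  have Pv : P *m v != 0.
    by apply: contra v0 => /eqP/(canRL (mulKmx Pu)) ->; rewrite mulmx0.
  have /eqP := congr1 (fun M => M *m v) PAd; rewrite -mulmxA Av mulmx0 -mulmxA.
  move: (P *m v) Pv => z z0 /eqP/esym dz.
  have [e ze] : exists e, z e 0 != 0.
    apply: contra_notP (negP z0) => h; apply/eqP/matrixP => i j.
    rewrite ord1 [RHS]mxE; apply/eqP; apply: contra_notT h => zi; by exists i.
  exists e; apply/eqP; have := congr1 (fun M : 'cV[R]_n => M e 0) dz.
  by rewrite mul_diag_mx !mxE => /eqP; rewrite mulf_eq0 (negbTE ze) orbF.
have d_eq0 i : (d 0 i == 0) = (i == e).
  apply/eqP/eqP => [di|->//]; apply/eqP; apply: contra_eqT (erefl (0:R)) => ie.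
  have [a pa] : exists a, p i = a *: v by apply: Aker; rewrite Ap di scale0r.
  have [b pb] : exists b, p e = b *: v by apply: Aker; rewrite Ap de scale0r.
  have b0 : b = 0.
    by apply: (@p_lin i e b a) => //; rewrite pa pb !scalerA mulrC.
  by case/eqP: (p0 e); rewrite pb b0 scale0r.
exists [seq d 0 i | i : 'I_n]; rewrite !count_image; split.
- exact: eigenvalue_list_diag PAd.
- rewrite -[n in RHS]card_ord -[RHS](cardC1 e); apply: eq_card => i.
  by rewrite !inE lt0r d_eq0 d_ge0 andbT.
- by rewrite -[RHS](card1 e); apply: eq_card => i; rewrite !inE d_eq0.
- by apply: eq_card0 => i; rewrite !inE ltNge d_ge0.
Qed.

Lemma discr_mx_signs n (H : 'M[R]_n) v k : H^T = H ->
  eigenvalue_signs H n.-1 0 1 -> qform H v < 0 -> 0 < k ->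
  eigenvalue_signs (k *: discr_mx H v) n.-1 1 0.
Proof.
move=> HT Hs v0 k0; apply: (@psd_line_kernel_signs _ _ v).
- by rewrite linearZ/= tr_discr_mx.
- by apply: contraTneq v0 => ->; rewrite /qform mulmx0 mxE ltxx.
- by rewrite -scalemxAl discr_mx_ker scaler0.
- by move=> x; rewrite /qform -scalemxAr -scalemxAl mxE pmulr_rge0// discr_mx_ge0.
- move=> x /eqP; rewrite -scalemxAl scaler_eq0 gt_eqF//= => /eqP Ax.
  by apply: (discr_mx_eq0 HT Hs v0); rewrite /qform -mulmxA Ax mulmx0 mxE.
Qed.

Lemma hyperbolic_unitmx n (H : 'M[R]_n) :
  eigenvalue_signs H n.-1 0 1 -> H \in unitmx.
Proof.
move=> [s [Hs _ s0 _]]; rewrite unitmxE unitfE.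
have H0 : ~~ root (char_poly H) 0.
  rewrite Hs root_prod_XsubC; apply/negP => s_0.
  by move/eqP: s0; rewrite -leqn0 leqNgt -has_count => /hasP; case; exists 0.
apply: contra H0 => /eqP H0.
by rewrite rootE horner_coef0 char_poly_det H0 mulr0.
Qed.

End Lorentzian.

(** * Restriction of a quadratic function to a line *)

Section LineRestriction.
Variable R : realType.
Implicit Types n : nat.

Lemma sup_max (A : set R) m : is_max A m -> sup A = m.
Proof.
move=> [Am ubA]; apply/eqP; rewrite eq_le ge_sup//=; last by exists m.
by apply: ub_le_sup => //; exists m.
Qed.

Lemma set_maxE (A : set R) m : is_max A m -> set_max A = m.
Proof.
move=> Am; have [Am' ubm'] : is_max A (set_max A) by apply: xgetPex; exists m.
by apply/eqP; rewrite eq_le (proj2 Am)//= ubm'//; exact: (proj1 Am).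
Qed.

Lemma enorm_scale n a (v : 'cV[R]_n) : enorm (a *: v) = `|a| * enorm v.
Proof.
rewrite /enorm -sqrtr_sqr -sqrtrM ?sqr_ge0// mulr_sumr; congr Num.sqrt.
by apply: eq_bigr => i _; rewrite mxE exprMn.
Qed.

Lemma enorm1_dot n (v : 'cV[R]_n) : enorm v = 1 -> (v^T *m v) 0 0 = 1.
Proof.
move=> v1; rewrite -[RHS](expr1n _ 2) -v1 sqr_sqrtr; last first.
  by apply: sumr_ge0 => i _; exact: sqr_ge0.
by rewrite mxE; apply: eq_bigr => i _; rewrite mxE expr2.
Qed.

Section Line.
Variables (n : nat) (H : 'M[R]_n) (g : 'cV[R]_n) (c l : R) (v : 'cV[R]_n).
Local Notation f := (quad H g c).
Local Notation s := (qform H v).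

(** For symmetric H, the derivative of t |-> f (x + t v) at t = 0. *)
Definition line_slope x := bform H v x + (g^T *m v) 0 0.

(** The discriminant of f (x + t v) - l as a polynomial in t. *)
Definition line_discr x := line_slope x ^+ 2 - 2 * s * (f x - l).

(** For s < 0, the parameter t maximizing f (x + t v), hence the midpoint of the
    interval where f (x + t v) >= l, if that is nonempty. *)
Definition line_mid x := - line_slope x / s.

(** Half the length of that interval. Num.sqrt is 0 on negative
    numbers, so this is meaningful only if line_discr x >= 0. *)
Definition line_radius x := Num.sqrt (line_discr x) / - s.

Hypothesis HT : H^T = H.
Hypothesis s_lt0 : s < 0.

Lemma quad_line x t :
  f (x + t *: v) = f x + t * line_slope x + 2^-1 * t ^+ 2 * s.
Proof.
rewrite /quad -[x in qform H (x + _)]scale1r qform_lin// mulmxDr -scalemxAr.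
rewrite [in LHS]mxE /line_slope (bformC v)//.
move: (g^T *m x) (g^T *m v) => a b; by rewrite !mxE; field.
Qed.

Lemma line_superlevelE x t :
  (l <= f (x + t *: v)) = ((s * t + line_slope x) ^+ 2 <= line_discr x).
Proof.
rewrite quad_line /line_discr -subr_ge0 -[RHS]subr_ge0.
have k0 : 0 < - 2 * s by have := s_lt0; lra.
by rewrite -[LHS](pmulr_lge0 _ k0); congr (_ <= _); field.
Qed.

Lemma line_levelE x t :
  f (x + t *: v) = l <-> (s * t + line_slope x) ^+ 2 = line_discr x.
Proof.
rewrite quad_line /line_discr; split=> [<-|E]; first by field.
have k0 : s != 0 by rewrite lt_eqF.
apply: (mulfI k0); lra.
Qed.

Lemma line_superlevel_set0 x : line_discr x < 0 ->
  line_superlevel f l v x = set0.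
Proof.
move=> D0; rewrite -subset0 => _ [t /= + _]; rewrite line_superlevelE.
by move=> /le_lt_trans/(_ D0); rewrite ltNge sqr_ge0.
Qed.

Section Nonempty.
Variable x : 'cV[R]_n.
Hypothesis D_ge0 : 0 <= line_discr x.
Let m := line_mid x.
Let r := line_radius x.

Lemma line_radius_ge0 : 0 <= r.
Proof. by rewrite /r /line_radius divr_ge0 ?sqrtr_ge0// oppr_ge0 ltW. Qed.

Let slopeE : line_slope x = - s * m.
Proof. by rewrite /m /line_mid; field; rewrite lt_eqF. Qed.

Let discrE : line_discr x = (s * r) ^+ 2.
Proof.
rewrite -[LHS]sqr_sqrtr// /r /line_radius; field.
by rewrite lt_eqF.
Qed.

Lemma line_superlevel_interval t :
  (l <= f (x + t *: v)) = (m - r <= t <= m + r).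
Proof.
rewrite line_superlevelE slopeE discrE mulNr -mulrBr ![(s * _) ^+ 2]exprMn.
rewrite ler_pM2l; last by rewrite exprn_even_gt0//= lt_eqF.
rewrite -(real_normK (num_real (t - m))) ler_pXn2r ?nnegrE//.
  by rewrite ler_distl.
exact: line_radius_ge0.
Qed.

Lemma line_level_endpoints t : f (x + t *: v) = l <-> t = m - r \/ t = m + r.
Proof.
rewrite line_levelE slopeE discrE mulNr -mulrBr ![(s * _) ^+ 2]exprMn.
split=> [|[]->]; try ring.
move=> /(mulfI _)/eqP; rewrite eqf_sqr => /(_ _)/orP[].
- by rewrite expf_neq0 ?lt_eqF.
- by move=> /eqP E; right; rewrite -E; ring.
- by move=> /eqP E; left; rewrite -E; ring.
Qed.

Lemma line_superlevel_segment :
  line_superlevel f l v x = segment (x + (m - r) *: v) (x + (m + r) *: v).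
Proof.
have segE t : (1 - t) *: (x + (m - r) *: v) + t *: (x + (m + r) *: v) =
    x + (m - r + 2 * r * t) *: v.
  by apply/matrixP => i j; rewrite !mxE; ring.
have r0 := line_radius_ge0.
apply/seteqP; split=> [_ [t /= + <-]|_ [t /= /andP[t0 t1] <-]].
  rewrite line_superlevel_interval => /andP[t0 t1].
  (* For r = 0 this quotient is 0, and t = m is forced. *)
  exists ((t - (m - r)) / (2 * r)).
    have [r_eq0|r_neq0] := eqVneq r 0.
      by rewrite r_eq0 mulr0 invr0 mulr0 /= lexx ler01.
    have r_gt0 : 0 < 2 * r by rewrite mulr_gt0// lt0r r_neq0.
    by rewrite /= divr_ge0 ?subr_ge0// ?(ltW r_gt0)//= ler_pdivrMr//; lra.
  rewrite segE; congr (x + _ *: v).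
  have [r_eq0|r_neq0] := eqVneq r 0; last by field.
  by rewrite r_eq0 in t0 t1 *; lra.
rewrite segE; exists (m - r + 2 * r * t) => //=.
rewrite line_superlevel_interval; apply/andP; split; nra.
Qed.

Hypothesis v1 : enorm v = 1.

Let in_line t : m - r <= t <= m + r -> line_superlevel f l v x (x + t *: v).
Proof. by rewrite -line_superlevel_interval => ?; exists t. Qed.

Let mr : m - r <= m - r <= m + r.
Proof. by have := line_radius_ge0; rewrite lexx/=; lra. Qed.
Let mr' : m - r <= m + r <= m + r.
Proof. by have := line_radius_ge0; rewrite lexx andbT; lra. Qed.

Lemma line_superlevel_nonempty : line_superlevel f l v x !=set0.
Proof. by exists (x + (m - r) *: v); exact: in_line. Qed.

Lemma parallel_distE : parallel_dist f l v x = 2 * r.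
Proof.
rewrite /parallel_dist; case: ifPn => [/eqP C0|_].
  by have := line_superlevel_nonempty; rewrite C0 => -[].
have r0 := line_radius_ge0.
apply: sup_max; split.
  exists (x + (m + r) *: v); first exact: in_line.
  exists (x + (m - r) *: v); first exact: in_line.
  rewrite opprD addrACA subrr add0r -scalerBl enorm_scale v1 mulr1.
  by rewrite ger0_norm; lra.
move=> _ [_ [t + <-]] [_ [t' + <-] <-]; rewrite /= !line_superlevel_interval.
move=> /andP[t0 t1] /andP[t0' t1'].
rewrite opprD addrACA subrr add0r -scalerBl enorm_scale v1 mulr1 ler_norml; lra.
Qed.

Let dotE t : (v^T *m (x + t *: v)) 0 0 = (v^T *m x) 0 0 + t.
Proof.
have := enorm1_dot v1; rewrite mulmxDr -scalemxAr.
move: (v^T *m x) (v^T *m v) => a b.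
by rewrite !mxE => ->; rewrite mulr1.
Qed.

Lemma parallel_set1_max :
  is_max (parallel_set1 f l v x) ((v^T *m x) 0 0 + (m + r)).
Proof.
split.
  exists (x + (m + r) *: v); last exact: dotE.
  by split; [apply/line_level_endpoints; right|exact: in_line].
move=> _ [_ [_ [t + <-]] <-].
rewrite /= dotE line_superlevel_interval => /andP[_].
by rewrite lerD2l.
Qed.

Lemma parallel_set2_max :
  is_max (parallel_set2 f l v x) (- ((v^T *m x) 0 0 + (m - r))).
Proof.
split.
  exists (x + (m - r) *: v); last by rewrite dotE.
  by split; [apply/line_level_endpoints; left|exact: in_line].
move=> _ [_ [_ [t + <-]] <-].
rewrite /= dotE line_superlevel_interval => /andP[+ _].
by rewrite lerN2 lerD2l.
Qed.

Lemma parallel_dist_sum :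
  parallel_dist f l v x = parallel_dist1 f l v x + parallel_dist2 f l v x.
Proof.
rewrite parallel_distE /parallel_dist1 /parallel_dist2.
by rewrite (set_maxE parallel_set1_max) (set_maxE parallel_set2_max); ring.
Qed.

End Nonempty.

Lemma line_discrE x : line_discr x =
  qform (discr_mx H v) x
  + 2 * (((g^T *m v) 0 0 *: (v^T *m H) - s *: g^T) *m x) 0 0
  + ((g^T *m v) 0 0 ^+ 2 + s * (- 2 * c + 2 * l)).
Proof.
rewrite qform_discr_mx// mulmxBl -!scalemxAl.
have -> : v^T *m H *m x = (bform H v x)%:M by rewrite [LHS]mx11_scalar.
rewrite /line_discr /line_slope /quad.
move: (g^T *m x) (g^T *m v) => a b; by rewrite !mxE eqxx mulr1n; field.
Qed.

Lemma parallel_dist_sqE x : enorm v = 1 ->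
  parallel_dist f l v x ^+ 2 = Num.max 0 (4 / s ^+ 2 * line_discr x).
Proof.
move=> v1; have k0 : 0 < 4 / s ^+ 2.
  by rewrite divr_gt0// exprn_even_gt0//= lt_eqF.
have [D0|D0] := ltP (line_discr x) 0.
  rewrite /parallel_dist line_superlevel_set0// eqxx expr0n/=.
  by rewrite max_l// pmulr_rle0// ltW.
rewrite parallel_distE// max_r; last by rewrite mulr_ge0// ltW.
rewrite -[in RHS](sqr_sqrtr D0) /line_radius; field.
by rewrite lt_eqF.
Qed.
End Line.

End LineRestriction.

(** * Derivatives of quadratic polynomials *)

Section QuadraticDerivatives.
Variable R : realType.
Implicit Types n : nat.

(** The quadratic polynomial with matrix A, linear part w and constant k. *)
Definition quad_fun n (A : 'M[R]_n) (w : 'rV[R]_n) (k : R) (x : 'cV[R]_n) : R :=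
  qform A x + (w *m x) 0 0 + k.

Lemma quad_fun_differentiable n A w k (x : 'cV[R]_n) :
  differentiable (quad_fun A w k) x.
Proof.
have -> : quad_fun A w k =
    \sum_i (fun y : 'cV[R]_n => \sum_j y i 0 * A i j * y j 0 + w 0 i * y i 0)
    + cst k.
  apply/funext => y; rewrite /quad_fun qform_sum mxE fctE fct_sumE -big_split.
  done.
apply: differentiableD; last exact: differentiable_cst.
apply: differentiable_sum => i; apply: differentiableD; last first.
  by apply: differentiableM => //; exact: differentiable_coord.
rewrite (_ : (fun _ => _) = \sum_j (fun y : 'cV[R]_n => y i 0 * A i j * y j 0)).
  apply: differentiable_sum => j.
  by do ?apply: differentiableM => //; exact: differentiable_coord.
by apply/funext => y; rewrite fct_sumE.
Qed.

Lemma derive_quad_fun n A w k (x h : 'cV[R]_n) : A^T = A ->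
  'D_h (quad_fun A w k) x = 2 * bform A h x + (w *m h) 0 0.
Proof.
move=> AT; apply: cvg_lim => //.
pose F (t : R) := 2 * bform A h x + (w *m h) 0 0 + t * qform A h.
apply: (@cvg_trans _ (F @ 0^')).
  apply: near_eq_cvg; near=> t.
  have t0 : t != 0 by near: t; exact: nbhs_dnbhs_neq.
  rewrite /F /= /quad_fun -[x in qform A (_ + x)]scale1r.
  rewrite qform_lin// mulmxDr -scalemxAr.
  rewrite -[_ *: _]/(_ * _).
  move: (w *m h) (w *m x) => a b; rewrite !mxE.
  by field.
have -> : 2 * bform A h x + (w *m h) 0 0 = F 0 by rewrite /F mul0r addr0.
apply: cvg_within_filter.
have : continuous F.
  move=> t; apply: cvgD; first exact: cvg_cst.
  by apply: cvgM; [exact: cvg_id|exact: cvg_cst].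
exact.
Unshelve. all: by end_near. Qed.

Lemma qform0 n (x : 'cV[R]_n) : qform 0 x = 0.
Proof. by rewrite /qform mulmx0 mul0mx mxE. Qed.

(** A partial derivative of a quadratic polynomial is an affine function,
    encoded as a quadratic polynomial with zero matrix. *)
Lemma partial_quad_fun n A w k (i : 'I_n) : A^T = A ->
  partial (quad_fun A w k) i = quad_fun 0 (2 *: row i A) (w 0 i).
Proof.
move=> AT; apply/funext => x; rewrite /partial derive_quad_fun// /quad_fun.
rewrite qform0 add0r -scalemxAl [in RHS]mxE; congr (_ * _ + _).
  by rewrite /bform trmx_delta -rowE.
by rewrite -colE mxE.
Qed.

Lemma hessian_quad_fun n A w k (x : 'cV[R]_n) : A^T = A ->
  hessian (quad_fun A w k) x = 2 *: A.
Proof.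
move=> AT; apply/matrixP => i j; rewrite /hessian mxE partial_quad_fun//.
rewrite partial_quad_fun ?trmx0// /quad_fun qform0 row0.
rewrite scaler0 mul0mx !mxE !add0r.
by rewrite -[in LHS]AT mxE.
Qed.

Lemma near_eq_differentiable (K : numFieldType) (V W : normedModType K)
    (F G : V -> W) (x : V) :
  (\forall y \near x, F y = G y) -> differentiable F x -> differentiable G x.
Proof.
move=> FG dF; have FGx := nbhs_singleton FG.
have [dFc /eqaddoP Fo] := (diff_locallyP _ _).1 dF.
have Go : G \o shift x = cst (G x) + 'd F x +o_ 0 id.
  apply/eqaddoP => e e0; have := Fo e e0.
  apply: filter_app; near=> h.
  suff -> : (F \o shift x - (cst (F x) + 'd F x)) h =
      (G \o shift x - (cst (G x) + 'd F x)) h by [].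
  rewrite !fctE /= FGx; congr (_ - _).
  near: h.
  have := FG; rewrite (near_shift 0 x) /=.
  by apply: filterS => h /=; rewrite subr0.
have dGE := diff_unique dFc Go.
by apply/diff_locallyP; rewrite dGE.
Unshelve. all: by end_near. Qed.

End QuadraticDerivatives.

(** * The squared parallel distance *)

Section SquaredDistance.
Variable R : realType.
Implicit Types n : nat.

Lemma qformZ n (A : 'M[R]_n) k x : qform (k *: A) x = k * qform A x.
Proof. by rewrite /qform -scalemxAr -scalemxAl mxE. Qed.

Lemma quad_fun_convex n (A : 'M[R]_n) w k (x y : 'cV[R]_n) t : A^T = A ->
  (forall z, 0 <= qform A z) -> 0 <= t <= 1 ->
  quad_fun A w k (t *: x + (1 - t) *: y) <=
  t * quad_fun A w k x + (1 - t) * quad_fun A w k y.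
Proof.
move=> AT Apos /andP[t0 t1]; rewrite /quad_fun qform_lin// mulmxDr -!scalemxAr.
(* The defect of linearity is t (1 - t) (x - y)^T A (x - y). *)
have := Apos (1 *: x + -1 *: y); rewrite qform_lin//.
have t01 : 0 <= t * (1 - t) by rewrite mulr_ge0// subr_ge0.
move=> /(mulr_ge0 t01).
move: (w *m x) (w *m y) => a b; rewrite !mxE; lra.
Qed.

(** Where max(0, Q) is positive it agrees with Q near the point. *)
Lemma eq_max_hessian n (F Q : 'cV[R]_n -> R) A w k x : A^T = A ->
  Q = quad_fun A w k -> (forall y, F y = Num.max 0 (Q y)) -> 0 < F x ->
  twice_differentiable F x /\ hessian F x = 2 *: A.
Proof.
move=> AT QE FE Fx.
have Qx : 0 < Q x by move: Fx; rewrite FE lt_max ltxx.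
have Qc : {for x, continuous Q}.
  by rewrite QE; apply: differentiable_continuous; exact: quad_fun_differentiable.
have QF : \forall y \near x, Q y = F y.
  have : \forall y \near x, 0 < Q y by exact: (cvgr_gt _ Qc).
  by apply: filterS => y Qy; rewrite FE max_r// ltW.
have QF2 : \forall y \near x, \forall z \near y, Q z = F z.
  by apply: nbhs_interior.
have pQF i : \forall y \near x, partial Q i y = partial F i y.
  by apply: filterS QF2 => y; exact: near_eq_derive.
split; first split.
- apply: filterS QF2 => y /near_eq_differentiable; apply.
  by rewrite QE; exact: quad_fun_differentiable.
- move=> i; apply: near_eq_differentiable (pQF i) _.
  by rewrite QE partial_quad_fun//; exact: quad_fun_differentiable.
rewrite -(hessian_quad_fun w k x AT); apply/matrixP => i j.
by rewrite /hessian !mxE -QE; apply/esym/near_eq_derive/pQF.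
Qed.

Section V.
Variables (n : nat) (H : 'M[R]_n) (g : 'cV[R]_n) (c l : R) (v : 'cV[R]_n).
Hypotheses (HT : H^T = H) (Hs : eigenvalue_signs H n.-1 0 1).
Hypotheses (v1 : enorm v = 1) (s_lt0 : qform H v < 0).
Local Notation f := (quad H g c).
Local Notation s := (qform H v).

(* In line_discrE the expression scaled by k is a quadratic polynomial with
   coefficients A / k, w / k and b / k. *)
Let k : R := 4 / s ^+ 2.
Let A := k *: discr_mx H v.
Let w : 'rV[R]_n := (k * 2) *: ((g^T *m v) 0 0 *: (v^T *m H) - s *: g^T).
Let b : R := k * ((g^T *m v) 0 0 ^+ 2 + s * (- 2 * c + 2 * l)).

Let k_gt0 : 0 < k.
Proof. by rewrite /k divr_gt0// exprn_even_gt0//= lt_eqF. Qed.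

Let AT : A^T = A.
Proof. by rewrite /A linearZ/= tr_discr_mx. Qed.

Let A_ge0 x : 0 <= qform A x.
Proof.
by rewrite /A qformZ mulr_ge0 ?(ltW k_gt0) ?discr_mx_ge0.
Qed.

Lemma parallel_dist_sq_quad x :
  parallel_dist_sq f l v x = Num.max 0 (quad_fun A w b x).
Proof.
rewrite /parallel_dist_sq parallel_dist_sqE// -/k line_discrE//.
congr Num.max; rewrite /quad_fun /A /w /b qformZ -scalemxAl.
by move: ((_ - _) *m x) => y; rewrite [(_ *: y) _ _]mxE; ring.
Qed.

Lemma parallel_dist_sq_hessian x : 0 < parallel_dist f l v x ->
  twice_differentiable (parallel_dist_sq f l v) x /\
  eigenvalue_signs (hessian (parallel_dist_sq f l v) x) n.-1 1 0.
Proof.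
move=> px; have Fx : 0 < parallel_dist_sq f l v x by rewrite exprn_gt0.
have [? ->] := eq_max_hessian AT erefl parallel_dist_sq_quad Fx; split=> //.
by rewrite /A scalerA; apply: discr_mx_signs => //; rewrite mulr_gt0.
Qed.

Lemma parallel_dist_sq_convex :
  convex_function (setT : set (convex_lmodType 'cV[R]_n))
    (parallel_dist_sq f l v).
Proof.
move=> t x y _ _; rewrite convRE.
have t01 : 0 <= t%:num <= 1 by rewrite ge0 le1.
have [t0 t1] : 0 <= t%:num /\ 0 <= 1 - t%:num.
  by move: t01 => /andP[? ?]; rewrite subr_ge0.
rewrite !parallel_dist_sq_quad ge_max; apply/andP; split.
  by rewrite addr_ge0// mulr_ge0// le_max lexx.
apply: le_trans (quad_fun_convex w b x y AT A_ge0 t01) _.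
by apply: lerD; apply: ler_wpM2l => //; rewrite le_max lexx orbT.
Qed.

Section Saddle.
Let xbar := - (invmx H *m g).

Let Hxbar : H *m xbar = - g.
Proof. by rewrite /xbar mulmxN mulKVmx// hyperbolic_unitmx. Qed.

Let slope_saddle y : line_slope H g v (xbar + y) = bform H v y.
Proof.
rewrite /line_slope -[X in X + y]scale1r -[y in LHS]scale1r bform_lin.
have -> : bform H v xbar = - (g^T *m v) 0 0.
  rewrite bformC// /bform -[in xbar^T *m H]HT -trmx_mul Hxbar linearN/=.
  by rewrite mulNmx mxE.
ring.
Qed.

Let quad_saddle y : f (xbar + y) = f xbar + 2^-1 * qform H y.
Proof.
rewrite /quad -[in LHS](scale1r y) -{1}[xbar]scale1r qform_lin// scale1r.
have -> : bform H xbar y = - (g^T *m y) 0 0.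
  by rewrite /bform -[in xbar^T *m H]HT -trmx_mul Hxbar linearN/= mulNmx mxE.
rewrite mulmxDr; move: (g^T *m xbar) (g^T *m y) => a d; rewrite !mxE.
by field.
Qed.

(** The discriminant, centred at the saddle point, has no linear term. *)
Lemma line_discr_saddle y :
  line_discr H g c l v (xbar + y) =
  qform (discr_mx H v) y - 2 * s * (f xbar - l).
Proof.
by rewrite /line_discr slope_saddle quad_saddle qform_discr_mx//; field.
Qed.

(** Since l < f xbar, the discriminant is positive everywhere, so a minimizer
    of the squared parallel distance minimizes the discriminant and thus lies
    on the line through xbar with direction v. *)
Lemma parallel_dist_minimizer xt : l < f xbar ->
  (forall x, parallel_dist_sq f l v xt <= parallel_dist_sq f l v x) ->
  exists y1 y2 : 'cV[R]_n,
    [/\ y1 != y2,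
        [set xt + t *: v | t in setT] `&` [set y | f y = l] = [set y1; y2] &
        xbar = 2^-1 *: (y1 + y2)].
Proof.
move=> lf xt_min.
have D_gt0 x : 0 < line_discr H g c l v x.
  rewrite -(subrKC xbar x) line_discr_saddle ltr_wpDl ?discr_mx_ge0//.
  by rewrite -mulNr mulr_gt0 ?subr_gt0// -mulrN mulr_gt0// oppr_gt0.
have [a xtE] : exists a, xt = xbar + a *: v.
  have [a xta] : exists a, xt - xbar = a *: v.
    apply: (discr_mx_eq0 HT Hs s_lt0).
    have := xt_min (xbar + 0).
    rewrite /parallel_dist_sq !parallel_dist_sqE// -/k.
    rewrite !max_r ?(ltW (mulr_gt0 k_gt0 (D_gt0 _)))// ler_pM2l//.
    rewrite -{1}(subrKC xbar xt) !line_discr_saddle lerD2r.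
    by rewrite {2}/qform mulmx0 mxE.
  by exists a; rewrite -xta subrKC.
have s0 : s != 0 by rewrite lt_eqF.
have mE : line_mid H g v xt = - a.
  rewrite /line_mid xtE slope_saddle.
  have -> : bform H v (a *: v) = a * s by rewrite /bform -scalemxAr mxE.
  by field.
have r0 : 0 < line_radius H g c l v xt.
  by rewrite divr_gt0 ?sqrtr_gt0// oppr_gt0.
have lev t := line_level_endpoints HT s_lt0 (ltW (D_gt0 xt)) t.
rewrite mE in lev; move: (line_radius _ _ _ _ _ _) r0 lev => r r0 lev.
exists (xt + (- a - r) *: v); exists (xt + (- a + r) *: v); split.
- apply/eqP => /addrI/eqP; rewrite -subr_eq0 -scalerBl scaler_eq0 => /orP[|].
    by apply/negP; rewrite lt_eqF//; lra.
  by move=> /eqP v0; move: s_lt0; rewrite v0 /qform mulmx0 mxE ltxx.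
- apply/seteqP; split=> [_ [[t _ <-] /= /lev[] ->]|_ [] ->].
  + by left.
  + by right.
  + by split; [exists (- a - r)|apply/lev; left].
  + by split; [exists (- a + r)|apply/lev; right].
- rewrite xtE; apply/matrixP => i j; rewrite !mxE.
  move: ((invmx H *m g) i j) => z.
  by field.
Qed.
End Saddle.
End V.

End SquaredDistance.

Theorem proposition2p1 (R : realType) (n : nat) (H : 'M[R]_n) (g : 'cV[R]_n)
    (c l : R) :
  let f := quad H g c in
  let admissible (v : 'cV[R]_n) := enorm v = 1 /\ qform H v < 0 in
  H^T = H ->
  eigenvalue_signs H n.-1 0 1 ->
  [/\ (* (i) *)
      forall v, admissible v -> forall x,
        (line_superlevel f l v x = set0 \/
          exists a b, line_superlevel f l v x = segment a b) /\
        (line_superlevel f l v x !=set0 ->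
          [/\ is_max (parallel_set1 f l v x) (parallel_dist1 f l v x),
              is_max (parallel_set2 f l v x) (parallel_dist2 f l v x) &
              parallel_dist f l v x =
                parallel_dist1 f l v x + parallel_dist2 f l v x]),
      (* (ii) *)
      forall v, admissible v -> forall x,
        let s := qform H v in
        parallel_dist f l v x ^+ 2 =
        Num.max 0
          (4 / s ^+ 2 *
            (qform (H *m v *m v^T *m H - s *: H) x
             + 2 * (((g^T *m v) 0 0 *: (v^T *m H) - s *: g^T) *m x) 0 0
             + ((g^T *m v) 0 0 ^+ 2 + s * (- 2 * c + 2 * l)))),
      (* (iii) *)
      exists2 delta : R, 0 < delta &
        forall v, admissible v ->
        forall (u : 'cV[R]_n) (mu : R),
          enorm u = 1 -> mu < 0 -> H *m u = mu *: u -> enorm (v - u) < delta ->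
        forall x, 0 < parallel_dist f l v x ->
          twice_differentiable (parallel_dist_sq f l v) x /\
          eigenvalue_signs (hessian (parallel_dist_sq f l v) x) n.-1 1 0,
      (* (iv) *)
      forall v, admissible v ->
        convex_function (setT : set (convex_lmodType 'cV[R]_n))
          (parallel_dist_sq f l v) &
      (* (v) *)
      forall v, admissible v ->
        let xbar := - (invmx H *m g) in
        l < f xbar ->
        forall xt : 'cV[R]_n,
          (forall x, parallel_dist_sq f l v xt <= parallel_dist_sq f l v x) ->
          exists y1 y2 : 'cV[R]_n,
            [/\ y1 != y2,
                [set xt + t *: v | t in setT] `&` [set y | f y = l] =
                  [set y1; y2] &
                xbar = 2^-1 *: (y1 + y2)]].
Proof.
move=> f admissible HT Hs; split.
- move=> v [v1 s_lt0] x; have [D_lt0|D_ge0] := ltP (line_discr H g c l v x) 0.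
    rewrite /f line_superlevel_set0//; split; first by left.
    by case.
  split; last move=> _.
    right; exists (x + (line_mid H g v x - line_radius H g c l v x) *: v).
    exists (x + (line_mid H g v x + line_radius H g c l v x) *: v).
    exact: line_superlevel_segment.
  have max1 := parallel_set1_max HT s_lt0 D_ge0 v1.
  have max2 := parallel_set2_max HT s_lt0 D_ge0 v1.
  split; last exact: parallel_dist_sum.
    by rewrite /parallel_dist1 (set_maxE max1).
  by rewrite /parallel_dist2 (set_maxE max2).
- by move=> v [v1 s_lt0] x s; rewrite parallel_dist_sqE// line_discrE.
- (* The signature of the discriminant matrix depends only on v^T H v < 0, so
     every positive delta will do. *)
  exists 1 => // v [v1 s_lt0] u mu _ _ _ _ x.
  exact: parallel_dist_sq_hessian.
- by move=> v [v1 s_lt0]; exact: parallel_dist_sq_convex.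
- by move=> v [v1 s_lt0] xbar lf xt; exact: parallel_dist_minimizer.
Qed.
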